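(* Let $(V,\mu)$ and $(E,\tau)$ be positive measure spaces, $M:V\times E\to\mathbb{R}$ a $(\mu\times\tau)$-measurable function, and $wt:E\to\mathbb{R}$ a $\tau$-measurable function. Suppose that: (i) $0<\mu(V)<\infty$; (ii) $0<s:=\int_E wt\,d\tau<\infty$; (iii) $\int_{V\times E}|M(v,e)|\,|wt(e)|\,d(\mu\times\tau)<\infty$; (iv) for some real number $c$, $\int_V M(v,e)\,d\mu(v)=c$ for $\tau$-almost all $e\in E$. Let $\delta(v)=\int_E M(v,e)\,wt(e)\,d\tau(e)$, assume $\delta(v)>0$ for $\mu$-a.e. $v\in V$, and let $\bar\delta=\frac{cs}{\mu(V)}$. Assume that the function $(v,e)\mapsto\delta(v)\ln\left(\frac{\delta(v)}{\bar\delta}\right)M(v,e)\,wt(e)$ is $(\mu\times\tau)$-integrable, and define $$\mathcal H(\delta)=-\frac{1}{cs}\int_{V\times E}\delta(v)\ln\!\left(\frac{\delta(v)}{\bar\delta}\right)M(v,e)\,wt(e)\,d(\mu\times\tau).$$ Then $\mathcal H(\delta)\le0$, with equality if and only if $\delta(v)=\bar\delta$ for $\mu$-a.e. $v\in V$.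
   Context: $\mu\times\tau$ denotes the product measure on $V\times E$. Note that $\int_V\delta\,d\mu=cs$, so $cs>0$ and $\bar\delta>0$ is the $\mu$-average of $\delta$. *)

(* Defs.v *)
From HB Require Import structures.
From mathcomp Require Import all_boot all_order all_algebra.
From mathcomp Require Import all_classical all_reals all_analysis.

Set Implicit Arguments.
Unset Strict Implicit.
Unset Printing Implicit Defensive.

Import Order.TTheory GRing.Theory Num.Theory.
Import numFieldNormedType.Exports.

Local Open Scope classical_set_scope.
Local Open Scope ring_scope.

(* [pi] is a product measure of [mu] and [tau] on the product sigma-algebra.
   The library's [mu \x tau] requires [tau] to be sigma-finite, in which case
   it is such a measure (see [product_measure1_is_product]); when both factors
   are sigma-finite it is the only one.  Using the defining rectangle rule
   (with 0 * +oo = 0) avoids assuming sigma-finiteness of [tau]. *)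
Definition is_product_measure {d1 d2 : measure_display}
    {V : measurableType d1} {E : measurableType d2} {R : realType}
    (mu : {measure set V -> \bar R}) (tau : {measure set E -> \bar R})
    (pi : {measure set (V * E) -> \bar R}) : Prop :=
  forall (A : set V) (B : set E), measurable A -> measurable B ->
    pi (A `*` B) = (mu A * tau B)%E.

Lemma product_measure1_is_product (d1 d2 : measure_display)
    (V : measurableType d1) (E : measurableType d2) (R : realType)
    (mu : {measure set V -> \bar R})
    (tau : {sigma_finite_measure set E -> \bar R}) :
  is_product_measure mu tau (mu \x tau)%E.
Proof. by move=> A B mA mB; exact: product_measure1E. Qed.

Section entropy.
Context {d1 d2 : measure_display} {V : measurableType d1}
  {E : measurableType d2} {R : realType}.
Variables (mu : {measure set V -> \bar R}) (tau : {measure set E -> \bar R})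
  (pi : {measure set (V * E) -> \bar R}) (M : V * E -> R) (wt : E -> R) (c : R).

(* The real-valued integral [\int[_]_] is [fine] of the extended one: [degree]
   takes a junk value at the v for which the section is not integrable. *)
Definition degree (v : V) : R := \int[tau]_e (M (v, e) * wt e).

Definition total_weight : R := \int[tau]_e wt e.

Definition mean_degree : R := c * total_weight / fine (mu setT).

Definition entropy_integrand (p : V * E) : R :=
  degree p.1 * ln (degree p.1 / mean_degree) * M p * wt p.2.

Definition entropy : R :=
  - (1 / (c * total_weight)) * \int[pi]_p entropy_integrand p.

End entropy.

(* Main.v *)
(** Since [wt] is integrable, [tau] restricted to the set [S] where [wt <> 0]
    is sigma-finite, so [pi] agrees there with the product measure and, as all
    the integrands vanish off [V * S], Fubini applies.  It gives
    [\int delta dmu = c s], hence [cs > 0], and turns the integral defining the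
    entropy into [\int delta^2 ln (delta / m) dmu], with [m] the mean degree.
    The bound [ln x >= 1 - 1/x] yields [x^2 ln x >= (x - 1) + (x - 1)^2]; with
    [x = delta / m] the linear term integrates to [0], and the square leaves a
    nonnegative remainder vanishing only where [delta = m]. *)

From HB Require Import structures.
Require Import Defs.
From mathcomp Require Import all_boot all_order all_algebra.
From mathcomp Require Import all_classical all_reals all_analysis.
From mathcomp Require Import measurable_realfun ring lra.

Set Implicit Arguments.
Unset Strict Implicit.
Unset Printing Implicit Defensive.

Import Order.TTheory GRing.Theory Num.Theory.
Import numFieldNormedType.Exports.

Local Open Scope classical_set_scope.
Local Open Scope ring_scope.

(** Taking [ln y <= y - 1] at [y = 1/x] gives [ln x >= 1 - 1/x]; multiplied by [x^2], the right side
    becomes [x^2 - x], which is the stated polynomial. Keeping the square is what later settles the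
    equality case. *)
Lemma sqr_ln_ge (R : realType) (x : R) : 0 < x ->
  (x - 1) + (x - 1) ^+ 2 <= x ^+ 2 * ln x.
Proof.
move=> x0; have xV0 : 0 < x^-1 by rewrite invr_gt0.
have lnxV : ln x^-1 <= x^-1 - 1.
  by rewrite -{1}(subrKC 1 x^-1) le_ln1Dx//; lra.
have lnx : 1 - x^-1 <= ln x by rewrite lnV ?posrE// in lnxV; lra.
have -> : (x - 1) + (x - 1) ^+ 2 = x ^+ 2 * (1 - x^-1) by field; rewrite gt_eqF.
by rewrite ler_pM2l// exprn_gt0.
Qed.

(** * Restriction to a support, and integrals of almost everywhere signed functions *)

Section measure_lemmas.
Context d (T : measurableType d) (R : realType) (mu : {measure set T -> \bar R}).
Local Open Scope ereal_scope.

(** The extended integral is the difference of the integrals of the positive and negative parts, and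
    [+oo - +oo] is [-oo]; a finite value therefore forces both parts to be finite. This turns
    hypotheses on the value of an integral into integrability. *)
Lemma integral_fin_num_integrable (f : T -> R) : measurable_fun setT f ->
  \int[mu]_x (f x)%:E \is a fin_num -> mu.-integrable setT (EFin \o f).
Proof.
move=> mf foo; apply/integrableP; split; first exact/measurable_EFinP.
by rewrite integral_fin_num_abs.
Qed.

Lemma integral_mrestr (D : set T) (mD : measurable D) (f : T -> \bar R) :
  (forall x, ~ D x -> f x = 0) -> \int[mrestr mu mD]_x f x = \int[mu]_x f x.
Proof.
move=> fD.
have fE : f = f \_ D.
  by apply/funext => x; rewrite patchE; case: ifPn => // /negP; rewrite inE => /fD.
rewrite fE -!integral_mkcond; apply: eq_measure_integral => A mA AD.
by rewrite /= /mrestr setIidl.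
Qed.

Lemma ae_mrestr (D : set T) (mD : measurable D) (P : T -> Prop) :
  {ae mu, forall x, P x} -> {ae mrestr mu mD, forall x, P x}.
Proof.
move=> [N [mN N0 PN]]; exists N; split=> //.
by apply: (subset_measure0 _ mN (@subIsetl _ N D) N0); exact: measurableI.
Qed.

(** The sets where [|f| >= 1/(n+1)] exhaust the support of [f], and each has finite measure by
    Markov's inequality. *)
Lemma sigma_finite_mrestr_integrable (f : T -> R)
    (mD : measurable [set x | f x != 0%R]) :
  mu.-integrable setT (EFin \o f) -> sigma_finite setT (mrestr mu mD).
Proof.
move=> /integrableP[/measurable_EFinP mf foo].
have mF n : measurable [set x | (n.+1%:R^-1)%:E <= `|(EFin \o f) x|].
  rewrite -[X in measurable X]setTI; apply: emeasurable_fun_c_infty => //.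
  by apply: measurableT_comp => //; exact/measurable_EFinP.
(* The complement of the support is added to cover [setT]; it is null for the
   restricted measure. *)
exists (fun n => ~` [set x | f x != 0%R] `|`
    [set x | (n.+1%:R^-1)%:E <= `|(EFin \o f) x|]).
  apply/esym/seteqP; split=> // x _.
  have [fx0|fx0] := eqVneq (f x) 0%R.
    by exists 0%N => //; left => /=; rewrite fx0 eqxx.
  have [n nf] : exists n, (n.+1%:R^-1 < `|f x|)%R.
    have /ltr_add_invr[n] : (0 < `|f x|)%R by rewrite normr_gt0.
    by rewrite add0r => ?; exists n.
  by exists n => //; right => /=; rewrite lee_fin ltW.
move=> n; split; first by apply: measurableU => //; exact: measurableC.
rewrite /mrestr setIUl setICl set0U.
have n0 : (0 < n.+1%:R^-1 :> R)%R by rewrite invr_gt0.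
(* Markov: [1/(n+1)] times the measure of the level set is at most the finite integral of [|f|], so
   that measure cannot be [+oo]. *)
have := @le_integral_abse _ _ _ mu _ measurableT (EFin \o f) _
  ((measurable_EFinP _ _).2 mf) n0.
move=> /le_lt_trans/(_ foo); rewrite setTI => Foo.
apply: (@le_lt_trans _ _ (mu [set x | (n.+1%:R^-1)%:E <= `|(EFin \o f) x|])).
  by apply: le_measure; rewrite ?inE//; exact: measurableI.
rewrite ltNge leye_eq; apply/negP => /eqP FE.
by move: Foo; rewrite FE gt0_muley ?lte_fin// ltxx.
Qed.

Lemma integrable_mrestr (D : set T) (mD : measurable D) (f : T -> \bar R) :
  (forall x, ~ D x -> f x = 0) -> mu.-integrable setT f ->
  (mrestr mu mD).-integrable setT f.
Proof.
move=> fD /integrableP[mf foo]; apply/integrableP; split=> //.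
by rewrite integral_mrestr// => x /fD ->; rewrite abse0.
Qed.

Lemma ae_eq_integrable (f g : T -> \bar R) : measurable_fun setT g ->
  ae_eq mu setT f g -> mu.-integrable setT f -> mu.-integrable setT g.
Proof.
move=> mg fg /integrableP[mf foo]; apply/integrableP; split=> //.
rewrite (le_lt_trans _ foo)// le_eqVlt; apply/orP; left; apply/eqP.
apply: ae_eq_integral => //; try exact: measurableT_comp.
exact/ae_eq_sym/ae_eq_abse.
Qed.

(** Almost everywhere [f = |f|], so the integral is that of [|f|], which vanishes exactly when [f]
    is null. *)
Lemma ae_ge0_Rintegral (f : T -> R) : mu.-integrable setT (EFin \o f) ->
  {ae mu, forall x, (0 <= f x)%R} ->
  (0 <= \int[mu]_x f x)%R /\
  ((\int[mu]_x f x)%R = 0%R <-> {ae mu, forall x, f x = 0%R}).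
Proof.
move=> intf f0; have mf := measurable_int _ intf.
have f_abs : (\int[mu]_x f x)%:E = \int[mu]_x `|(EFin \o f) x|.
  rewrite fineK; last exact: integrable_fin_num intf.
  apply: ae_eq_integral => //; first exact: measurableT_comp.
  by apply: filterS f0 => x fx _ /=; rewrite ger0_norm.
split; first by rewrite -lee_fin f_abs; exact: integral_ge0.
have := ae_eq_integral_abs mu measurableT mf.
rewrite -f_abs => f_eq0; split.
  move=> If; have /f_eq0 : (\int[mu]_x f x)%:E = 0 by rewrite If.
  by apply: filterS => x /(_ I)[].
move=> fx0; apply: EFin_inj; apply/f_eq0.
by apply: filterS fx0 => x /= ->.
Qed.

End measure_lemmas.

(** A zero integral would make [f] both zero and positive almost everywhere, so the whole space
    would be null. *)
Lemma ae_gt0_Rintegral_gt0 d (T : measurableType d) (R : realType)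
    (mu : {measure set T -> \bar R}) (f : T -> R) : (0 < mu setT)%E ->
  mu.-integrable setT (EFin \o f) -> {ae mu, forall x, 0 < f x} ->
  0 < \int[mu]_x f x.
Proof.
move=> muT0 intf f0.
have fge0 : {ae mu, forall x, 0 <= f x} by apply: filterS f0 => x; exact: ltW.
have [If0 IfE0] := ae_ge0_Rintegral intf fge0.
rewrite lt_neqAle If0 andbT eq_sym; apply/negP => /eqP/IfE0 fE0.
have [N [mN muN0 TN]] : {ae mu, forall x, False}.
  by apply: filterS2 f0 fE0 => x /[swap] ->; rewrite ltxx.
suff : mu setT = 0%E by move=> muT; rewrite muT ltxx in muT0.
by apply: (subset_measure0 _ mN _ muN0) => // x _; exact: TN.
Qed.

Lemma Rintegral_sqr_ln d (T : measurableType d) (R : realType)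
    (mu : {finite_measure set T -> \bar R}) (g : T -> R) (m : R) : 0 < m ->
  mu.-integrable setT (EFin \o g) ->
  \int[mu]_x g x = m * fine (mu setT) ->
  {ae mu, forall x, 0 < g x} ->
  mu.-integrable setT (EFin \o (fun x => g x ^+ 2 * ln (g x / m))) ->
  0 <= \int[mu]_x (g x ^+ 2 * ln (g x / m)) /\
  (\int[mu]_x (g x ^+ 2 * ln (g x / m)) = 0 <-> {ae mu, forall x, g x = m}).
Proof.
move=> m0 intg Ig g0; set h := (fun x => g x ^+ 2 * _) => inth.
have intm := finite_measure_integrable_cst mu m measurableT.
have intgm : mu.-integrable setT (EFin \o (fun x => g x - m)).
  by have := integrableB measurableT intg intm.
have intmgm : mu.-integrable setT (EFin \o (fun x => m * (g x - m))).
  by have := integrableZl measurableT m intgm.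
(* The subtracted term has integral zero because [m] is the mean of [g]; hence [k] and [h] have the
   same integral, while [k] is nonnegative pointwise wherever [g > 0]. *)
pose k x := h x - m * (g x - m).
have intk : mu.-integrable setT (EFin \o k).
  by have := integrableB measurableT inth intmgm.
have Ik : \int[mu]_x k x = \int[mu]_x h x.
  rewrite /k RintegralB// RintegralZl// RintegralB// Ig.
  by rewrite Rintegral_cst// subrr mulr0 subr0.
have k_ge x : 0 < g x -> (g x - m) ^+ 2 <= k x.
  move=> gx0; rewrite /k /h.
  (* The scalar inequality at [x = g x / m], scaled by [m^2] to clear the denominators. *)
  have := sqr_ln_ge (divr_gt0 gx0 m0).
  rewrite -(ler_pM2l (exprn_gt0 2 m0)) mulrA -exprMn mulrDr -exprMn.
  have -> : m * (g x / m) = g x by rewrite mulrC divfK// gt_eqF.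
  have -> : m ^+ 2 * (g x / m - 1) = m * (g x - m) by field; rewrite gt_eqF.
  have -> : m * (g x / m - 1) = g x - m by field; rewrite gt_eqF.
  by rewrite lerBrDl.
have k_ge0 : {ae mu, forall x, 0 <= k x}.
  by apply: filterS g0 => x /k_ge; apply: le_trans; exact: sqr_ge0.
have [] := ae_ge0_Rintegral intk k_ge0; rewrite Ik => Ih0 IhE0.
split=> //; rewrite IhE0; split; last first.
  apply: filterS => x gxm.
  by rewrite /k /h gxm divff ?gt_eqF// ln1 subrr !mulr0 subr0.
apply: filterS2 g0 => x /k_ge kx kx0; rewrite kx0 in kx.
by apply/eqP; rewrite -subr_eq0 -sqrf_eq0 eq_le kx sqr_ge0.
Qed.

(** * Fubini's theorem for real-valued iterated integrals *)

Section fubini.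
Context d1 d2 (V : measurableType d1) (E : measurableType d2) (R : realType).
Variables (mu : {sigma_finite_measure set V -> \bar R})
  (tau : {sigma_finite_measure set E -> \bar R}) (f : V * E -> R).
Hypothesis intf : (mu \x tau)%E.-integrable setT (EFin \o f).

(** Since [fine] sends infinite values to 0, it never increases absolute values, so the extended
    inner integral dominates the real one. *)
Lemma integrable_fubini_Rintegral :
  mu.-integrable setT (EFin \o (fun v => \int[tau]_e f (v, e))).
Proof.
apply: le_integrable (integrable_fubini_F intf) => //.
  apply/measurable_EFinP; apply: measurableT_comp (measurable_fubini_F intf).
  exact: fine_measurable measurableT.
have fine_le (x : \bar R) : (`|(fine x)%:E| <= `|x|)%E.
  by case: x => [r| |]//=; rewrite normr0 leey.
by move=> v _; exact: fine_le.
Qed.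

(** The extended inner integral is finite for almost every [v], and there [fine] loses nothing. *)
Lemma Rintegral12_prod_meas :
  \int[mu]_v \int[tau]_e f (v, e) = \int[(mu \x tau)%E]_p f p.
Proof.
congr fine; rewrite -integral12_prod_meas1//; apply: ae_eq_integral => //.
- exact: measurable_int integrable_fubini_Rintegral.
- exact: measurable_fubini_F intf.
have := integrable_ae measurableT (integrable_fubini_F intf).
by apply: filterS => v /(_ I) Fv _; rewrite fineK.
Qed.

End fubini.

(** * The entropy inequality for sigma-finite [tau] and the library's product measure *)

Lemma entropy_product (R : realType) (d1 d2 : measure_display)
    (V : measurableType d1) (E : measurableType d2)
    (mu : {finite_measure set V -> \bar R})
    (tau : {sigma_finite_measure set E -> \bar R})
    (M : V * E -> R) (wt : E -> R) (c : R) :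
  measurable_fun setT M ->
  (0 < mu setT)%E ->
  tau.-integrable setT (EFin \o wt) ->
  (mu \x tau)%E.-integrable setT (EFin \o (fun p => M p * wt p.2)) ->
  {ae tau, forall e, (\int[mu]_v (M (v, e))%:E = c%:E)%E} ->
  {ae mu, forall v, 0 < degree tau M wt v} ->
  (mu \x tau)%E.-integrable setT
    (fun p => (entropy_integrand mu tau M wt c p)%:E) ->
  entropy mu tau (mu \x tau)%E M wt c <= 0 /\
  (entropy mu tau (mu \x tau)%E M wt c = 0 <->
   {ae mu, forall v, degree tau M wt v = mean_degree mu tau wt c}).
Proof.
move=> mM muT0 intwt intW hc delta0 inth.
set g := degree tau M wt; set m := mean_degree mu tau wt c.
set s := total_weight tau wt.
have intg : mu.-integrable setT (EFin \o g).
  exact: (integrable_fubini_Rintegral intW).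
have Ig : \int[mu]_v g v = c * s.
  rewrite /g /degree.
  rewrite (Rintegral12_prod_meas intW).
  rewrite /s /total_weight -RintegralZl//.
  (* Integrating over [v] first, the inner integral is [c * wt e] for almost every [e]. *)
  congr fine; rewrite -integral21_prod_meas1//; apply: ae_eq_integral => //.
  - exact: (measurable_fubini_G intW).
  - by have /measurable_int := integrableZl measurableT c intwt.
  apply: filterS hc => e Me _; rewrite /fubini_G /=.
  under eq_integral do rewrite EFinM.
  rewrite integralZr//; first by rewrite Me.
  apply: integral_fin_num_integrable; last by rewrite Me.
  exact: measurable_fun_pair1.
have cs0 : 0 < c * s by rewrite -Ig; exact: ae_gt0_Rintegral_gt0.
have muT : 0 < fine (mu setT).
  by rewrite fine_gt0// muT0 /= fin_num_fun_lty//; exact: fin_num_measure.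
have m0 : 0 < m by exact: divr_gt0.
pose h v := g v ^+ 2 * ln (g v / m).
have mg : measurable_fun setT g by apply/measurable_EFinP/measurable_int/intg.
have mh : measurable_fun setT h.
  apply: measurable_funM; first exact: measurable_funX.
  apply: measurableT_comp; first exact: measurable_ln.
  exact: measurable_funM.
(* For fixed [v] the factor [g v * ln (g v / m)] is constant in [e], and integrating [M * wt]
   supplies the second factor [g v]. Pulling the constant out uses an integrable section, hence
   equality only almost everywhere. *)
have hE : ae_eq mu setT
    (EFin \o (fun v => \int[tau]_e entropy_integrand mu tau M wt c (v, e)))
    (EFin \o h).
  apply: filterS (ae_integrable1 intW) => v intWv _ /=; congr EFin.
  rewrite /entropy_integrand /= -/g -/m.
  under eq_Rintegral do rewrite -mulrA.
  by rewrite RintegralZl// -/(degree tau M wt v) -/g /h expr2 mulrAC.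
have Ih : \int[(mu \x tau)%E]_p entropy_integrand mu tau M wt c p =
    \int[mu]_v h v.
  rewrite -Rintegral12_prod_meas//; congr fine; apply: ae_eq_integral => //.
  - by have /measurable_int := integrable_fubini_Rintegral inth.
  - exact/measurable_EFinP.
have inth' : mu.-integrable setT (EFin \o h).
  apply: ae_eq_integrable hE _; first exact/measurable_EFinP.
  exact: (integrable_fubini_Rintegral inth).
have Igm : \int[mu]_v g v = m * fine (mu setT).
  by rewrite Ig /m /mean_degree -/s divfK// gt_eqF.
have [Ih0 IhE0] := Rintegral_sqr_ln m0 intg Igm delta0 inth'.
have cs_neq0 : - (1 / (c * s)) != 0 by rewrite oppr_eq0 div1r invr_eq0 gt_eqF.
rewrite /entropy -/s Ih; split.
  by rewrite mulNr oppr_le0 mulr_ge0// div1r invr_ge0 ltW.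
rewrite -IhE0; split=> [/eqP|->]; last by rewrite mulr0.
by rewrite mulf_eq0 (negbTE cs_neq0) => /eqP.
Qed.

(** * Reduction of an arbitrary [tau] to the sigma-finite case *)

(** Restricting [mu] to the whole space leaves its values unchanged and equips it with the
    finite-measure structure. *)
Lemma finite_measure_ex d (T : measurableType d) (R : realType)
    (mu : {measure set T -> \bar R}) : (mu setT < +oo)%E ->
  exists nu : {finite_measure set T -> \bar R},
    mu = nu :> {measure set T -> \bar R}.
Proof.
move=> muoo; exists (mfrestr measurableT muoo); apply: eq_measure.
by apply/funext => A; rewrite /= /mfrestr /mrestr setIT.
Qed.

(* An alias on which the sigma-finite structure can be declared. *)
Definition sigma_finite_copy d (T : measurableType d) (R : realType)
  (mu : {measure set T -> \bar R}) of sigma_finite setT mu :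
  set T -> \bar R := mu.

HB.instance Definition _ d (T : measurableType d) (R : realType)
    (mu : {measure set T -> \bar R}) (muoo : sigma_finite setT mu) :=
  Measure.on (sigma_finite_copy muoo).

HB.instance Definition _ d (T : measurableType d) (R : realType)
    (mu : {measure set T -> \bar R}) (muoo : sigma_finite setT mu) :=
  Measure_isSigmaFinite.Build d T R (sigma_finite_copy muoo) muoo.

Lemma sigma_finite_measure_ex d (T : measurableType d) (R : realType)
    (mu : {measure set T -> \bar R}) : sigma_finite setT mu ->
  exists nu : {sigma_finite_measure set T -> \bar R},
    mu = nu :> {measure set T -> \bar R}.
Proof.
by move=> muoo; exists (sigma_finite_copy muoo); exact: eq_measure.
Qed.

Theorem proposition4p2 (R : realType) (d1 d2 : measure_display)
    (V : measurableType d1) (E : measurableType d2)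
    (mu : {measure set V -> \bar R}) (tau : {measure set E -> \bar R})
    (pi : {measure set (V * E) -> \bar R})
    (hpi : is_product_measure mu tau pi)
    (M : V * E -> R) (wt : E -> R) (c : R)
    (mM : measurable_fun setT M) (mwt : measurable_fun setT wt)
    (hmu : (0 < mu setT < +oo)%E)
    (hs : (0 < \int[tau]_e (wt e)%:E < +oo)%E)
    (hMwt : (\int[pi]_p (`|M p| * `|wt p.2|)%:E < +oo)%E)
    (hc : {ae tau, forall e, (\int[mu]_v (M (v, e))%:E = c%:E)%E})
    (hdelta : {ae mu, forall v, 0 < degree tau M wt v})
    (hint : pi.-integrable setT
      (fun p => (entropy_integrand mu tau M wt c p)%:E)) :
  entropy mu tau pi M wt c <= 0 /\
  (entropy mu tau pi M wt c = 0 <->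
   {ae mu, forall v, degree tau M wt v = mean_degree mu tau wt c}).
Proof.
have [muT0 muToo] := andP hmu; have [s0 soo] := andP hs.
have [mu' mu'E] := finite_measure_ex muToo; subst mu.
have intwt : tau.-integrable setT (EFin \o wt).
  by apply: integral_fin_num_integrable => //; rewrite gt0_fin_numE.
have mS : measurable [set e | wt e != 0].
  have -> : [set e | wt e != 0] = wt @^-1` [set~ 0].
    by apply/seteqP; split=> e /= /eqP.
  rewrite -[X in measurable X]setTI; apply: mwt => //; exact: measurableC.
have wtS e : ~ (wt e != 0) -> wt e = 0 by move/negP; rewrite negbK => /eqP.
have [tau' tau'E] :=
  sigma_finite_measure_ex (sigma_finite_mrestr_integrable mS intwt).
(* Transport along [tau'E], with [P] ranging over plain measures so that the sigma-finite structure
   carried by [tau'] does not interfere. *)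
have tau'P (P : {measure set E -> \bar R} -> Prop) :
  P (mrestr tau mS) -> P tau' by rewrite tau'E.
have mVS : measurable ([set: V] `*` [set e | wt e != 0]) by exact: measurableX.
(* By uniqueness of the product measure for sigma-finite factors it suffices to compare rectangles:
   writing [S] for the support of [wt], [A * B] meets [V * S] in [A * (B & S)], to which the
   rectangle rule for [pi] applies. *)
have piE X : measurable X -> mrestr pi mVS X = (mu' \x tau')%E X.
  move=> mX; apply/esym/product_measure_unique => // A B mA mB.
  have tau'B : mrestr tau mS B = tau' B.
    exact: (tau'P (fun nu => mrestr tau mS B = nu B)).
  by rewrite -tau'B /= /mrestr -setXI setIT hpi//; exact: measurableI.
have int_pi f : (forall p, wt p.2 = 0 -> f p = 0%E) ->
    (\int[pi]_p f p = \int[(mu' \x tau')%E]_p f p)%E.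
  move=> f0; rewrite -(integral_mrestr pi mVS).
    by apply: eq_measure_integral => X mX _; exact: piE.
  by move=> p pS; apply/f0/wtS => wtp; exact: pS.
have integrable_pi f : (forall p, wt p.2 = 0 -> f p = 0%E) ->
    pi.-integrable setT f -> (mu' \x tau')%E.-integrable setT f.
  move=> f0 /integrableP[mf foo]; apply/integrableP; split=> //.
  by rewrite -int_pi// => p /f0 ->; rewrite abse0.
(* Every quantity in the statement integrates a multiple of [wt], so replacing [tau] by its
   restriction changes none of them. *)
have degreeE : degree tau' M wt = degree tau M wt.
  apply/funext => v; rewrite /degree /Rintegral -tau'E integral_mrestr//.
  by move=> e /wtS ->; rewrite mulr0.
have total_weightE : total_weight tau' wt = total_weight tau wt.
  rewrite /total_weight /Rintegral -tau'E integral_mrestr//.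
  by move=> e /wtS ->.
have mean_degreeE : mean_degree mu' tau' wt c = mean_degree mu' tau wt c.
  by rewrite /mean_degree total_weightE.
have integrandE : entropy_integrand mu' tau' M wt c =
    entropy_integrand mu' tau M wt c.
  by rewrite /entropy_integrand degreeE mean_degreeE.
have entropyE : entropy mu' tau pi M wt c =
    entropy mu' tau' (mu' \x tau')%E M wt c.
  rewrite /entropy total_weightE integrandE /Rintegral int_pi//.
  by move=> p wtp; rewrite /entropy_integrand wtp mulr0.
rewrite entropyE -degreeE -mean_degreeE.
apply: entropy_product => //.
- apply: (tau'P (fun nu => nu.-integrable setT (EFin \o wt))).
  by apply: integrable_mrestr intwt => e /wtS /= ->.
- apply: integrable_pi; first by move=> p /= ->; rewrite mulr0.
  apply/integrableP; split.
    by apply/measurable_EFinP/measurable_funM => //; exact: measurableT_comp.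
  by under eq_integral do rewrite /= normrM.
- apply: (tau'P (fun nu => {ae nu, forall e,
    (\int[mu']_v (M (v, e))%:E = c%:E)%E})).
  exact: ae_mrestr.
- by rewrite degreeE.
- rewrite integrandE; apply: integrable_pi hint => p wtp.
  by rewrite /entropy_integrand wtp mulr0.
Qed.
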